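(* Let $k\ge 2$, let $H'_1,\ldots,H'_k$ be subgroups of $G'=\mathbb{F}_{n'}\times\mathbb{Z}^{m'}$, and let $H''_1,\ldots,H''_k$ be subgroups of $G''=\mathbb{F}_{n''}\times\mathbb{Z}^{m''}$. Write $r'=\mathrm{rk}\big(\bigcap_{j=1}^k \pi(H'_j)\big)$ and $r''=\mathrm{rk}\big(\bigcap_{j=1}^k \pi(H''_j)\big)$ (possibly infinite), and consider the subgroups $\langle H'_1,H''_1\rangle,\ldots,\langle H'_k,H''_k\rangle$ of $G'\circledast G''=(\mathbb{F}_{n'}*\mathbb{F}_{n''})\times(\mathbb{Z}^{m'}\oplus\mathbb{Z}^{m''})$. Then, if $\min(r',r'')\neq 1$, $$\bigcap_{j=1}^k\langle H'_j,H''_j\rangle \text{ is finitely generated}\iff \text{both } \bigcap_{j=1}^k H'_j \text{ and } \bigcap_{j=1}^k H''_j \text{ are finitely generated.}$$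
   Context: $\mathbb{F}_n$ is the free group of rank $n$ and $\mathbb{Z}^m$ the free-abelian group of rank $m$. For a group $\mathbb{F}_n\times\mathbb{Z}^m$, $\pi$ denotes the projection to the free part $\mathbb{F}_n$; in particular $\pi(H'_j)\leqslant\mathbb{F}_{n'}$ and $\pi(H''_j)\leqslant\mathbb{F}_{n''}$. The rank $\mathrm{rk}$ of a free group lies in $\{0,1,2,\ldots,\infty\}$. The external strongly complementary product of $G'=\mathbb{F}_{n'}\times\mathbb{Z}^{m'}$ and $G''=\mathbb{F}_{n''}\times\mathbb{Z}^{m''}$ is $G'\circledast G''=(\mathbb{F}_{n'}*\mathbb{F}_{n''})\times(\mathbb{Z}^{m'}\oplus\mathbb{Z}^{m''})$, in which $G'$ and $G''$ are regarded as subgroups through the natural inclusions. *)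

(* Defs.v *)
From HB Require Import structures.
From mathcomp Require Import all_boot all_order all_algebra.
From mathcomp Require Import boolp classical_sets functions cardinality.

Set Implicit Arguments.
Unset Strict Implicit.
Unset Printing Implicit Defensive.

Import GRing.Theory.

Local Open Scope classical_set_scope.
Local Open Scope group_scope.

Section FreeGroup.
Variable X : choiceType.

(* (x, false) is the letter x and (x, true) is the letter x^-1. *)
Local Notation letter := (X * bool)%type.

Implicit Types (a b : letter) (u v w : seq letter).

Definition linv a : letter := (a.1, ~~ a.2).

Definition reduced w : bool := sorted (fun a b => b != linv a) w.

(* the reduced form of a :: w, for w reduced *)
Definition lpush a w : seq letter :=
  if w is b :: w' then if b == linv a then w' else a :: w else [:: a].

Definition word_mul u v : seq letter := foldr lpush v u.
Definition word_inv u : seq letter := rev (map linv u).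

Lemma linvK : involutive linv.
Proof. by case=> x b; rewrite /linv /= negbK. Qed.

Lemma reduced_tail a w : reduced (a :: w) -> reduced w.
Proof. exact: path_sorted. Qed.

Lemma lpush_reduced a w : reduced w -> reduced (lpush a w).
Proof.
case: w => [//|b w] rw /=; case: eqVneq => [_|nab].
  exact: reduced_tail rw.
by rewrite /reduced /= nab.
Qed.

Lemma lpush_cons a w : reduced (a :: w) -> lpush a w = a :: w.
Proof. by case: w => [//|b w] /= /andP[/negPf-> _]. Qed.

Lemma lpushK a w : reduced w -> lpush a (lpush (linv a) w) = w.
Proof.
case: w => [|b w] rw /=; first by rewrite eqxx.
rewrite linvK; case: eqVneq => [eba|_] /=; last by rewrite eqxx.
by rewrite -eba lpush_cons.
Qed.

Lemma word_mul_reduced u v : reduced v -> reduced (word_mul u v).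
Proof. by move=> rv; elim: u => //= a u; apply: lpush_reduced. Qed.

Lemma word_mul_push a u v : reduced u -> reduced v ->
  word_mul (lpush a u) v = lpush a (word_mul u v).
Proof.
case: u => [//|b u] ru rv /=; case: eqVneq => [->|//].
by rewrite lpushK //; apply: word_mul_reduced.
Qed.

Lemma word_mulA u v w : reduced v -> reduced w ->
  word_mul u (word_mul v w) = word_mul (word_mul u v) w.
Proof.
move=> rv rw; elim: u => //= a u ->.
by rewrite word_mul_push //; apply: word_mul_reduced.
Qed.

Lemma word_mul1 u : reduced u -> word_mul u [::] = u.
Proof.
elim: u => //= a u IHu ru; rewrite IHu ?lpush_cons //.
exact: reduced_tail ru.
Qed.

Lemma word_inv_reduced u : reduced u -> reduced (word_inv u).
Proof.
rewrite /reduced /word_inv rev_sorted sorted_map => ru.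
rewrite (@eq_sorted _ _ (fun a b => b != linv a)) // => a b.
by rewrite /= linvK eq_sym.
Qed.

Lemma word_mulV u : reduced u -> word_mul (word_inv u) u = [::].
Proof.
elim: u => // a u IHu ru; rewrite /word_inv /= rev_cons /word_mul foldr_rcons.
by rewrite /= linvK eqxx; apply: IHu; apply: reduced_tail ru.
Qed.

Lemma word_invK : involutive word_inv.
Proof. by move=> u; rewrite /word_inv map_rev revK mapK //; apply: linvK. Qed.

Record freeGroup : Type := FreeGroup {
  fword : seq letter;
  _ : reduced fword
}.

HB.instance Definition _ := [isSub for fword].
HB.instance Definition _ := [Choice of freeGroup by <:].

Lemma fwordP (g : freeGroup) : reduced (fword g). Proof. exact: valP. Qed.

Definition free_one : freeGroup := @FreeGroup [::] isT.
Definition free_mul (g h : freeGroup) : freeGroup :=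
  FreeGroup (word_mul_reduced (fword g) (fwordP h)).
Definition free_inv (g : freeGroup) : freeGroup :=
  FreeGroup (word_inv_reduced (fwordP g)).

Lemma free_mulA : associative free_mul.
Proof. by move=> g h k; apply/val_inj/word_mulA; apply: fwordP. Qed.
Lemma free_mul1g : left_id free_one free_mul.
Proof. by move=> g; apply/val_inj. Qed.
Lemma free_mulg1 : right_id free_one free_mul.
Proof. by move=> g; apply/val_inj/word_mul1/fwordP. Qed.
Lemma free_mulVg : left_inverse free_one free_inv free_mul.
Proof. by move=> g; apply/val_inj/word_mulV/fwordP. Qed.
Lemma free_mulgV : right_inverse free_one free_inv free_mul.
Proof.
by move=> g; rewrite -{1}[g](_ : free_inv (free_inv g) = g) ?free_mulVg //;
  apply/val_inj/word_invK.
Qed.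

HB.instance Definition _ := isGroup.Build freeGroup
  free_mulA free_mul1g free_mulg1 free_mulVg free_mulgV.

(* the homomorphism from the free group on X that extends f : X -> G *)
Definition free_lift (G : groupType) (f : X -> G) (g : freeGroup) : G :=
  \prod_(a <- fword g) (if a.2 then (f a.1)^-1 else f a.1).

Lemma free_lift_morph (G : groupType) (f : X -> G) :
  {morph free_lift f : g h / g * h}.
Proof.
move=> g h; rewrite /free_lift [fword (g * h)]/(word_mul (fword g) (fword h)).
elim: (fword g) => [|a u IHu] /=; first by rewrite big_nil mul1g.
rewrite big_cons -mulgA -IHu -/(word_mul u (fword h)).
case: (word_mul u (fword h)) => [|b w] /=; first by rewrite big_cons.
case: eqVneq => [->|_]; last by rewrite big_cons.
by rewrite big_cons mulgA /=; case: a.2; rewrite ?mulVg ?mulgV mul1g.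
Qed.

Lemma free_lift1 (G : groupType) (f : X -> G) : free_lift f 1 = 1.
Proof. exact: big_nil. Qed.

HB.instance Definition _ (G : groupType) (f : X -> G) :=
  isUMagmaMorphism.Build freeGroup G (free_lift f)
    (conj (free_lift1 f) (free_lift_morph f)).

Definition free_gen (x : X) : freeGroup := @FreeGroup [:: (x, false)] isT.

Lemma free_lift_gen (G : groupType) (f : X -> G) x :
  free_lift f (free_gen x) = f x.
Proof. by rewrite /free_lift big_seq1. Qed.

Lemma morph_free_lift (G : groupType) (f : freeGroup -> G) :
  {morph f : g h / g * h} -> f =1 free_lift (f \o free_gen).
Proof.
move=> fM; have f1 : f 1 = 1 by apply: (mulgI (f 1)); rewrite -fM !mulg1.
have fV g : f g^-1 = (f g)^-1.
  by apply: (mulgI (f g)); rewrite -fM !mulgV.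
case=> w; elim: w => [|a u IHu] rw.
  by rewrite (_ : FreeGroup rw = 1) ?f1 ?free_lift1 //; apply/val_inj.
have ra : reduced [:: a] by [].
have -> : FreeGroup rw = FreeGroup ra * FreeGroup (reduced_tail rw).
  by apply/val_inj; rewrite /= lpush_cons.
rewrite fM free_lift_morph IHu; congr (_ * _).
rewrite /free_lift big_seq1 /=; case: a ra {rw} => x [] rx /=; last first.
  by congr f; apply/val_inj.
by rewrite -fV; congr f; apply/val_inj.
Qed.

End FreeGroup.

Notation "''Free_' n" := (freeGroup 'I_n)
  (at level 0, n at level 2, format "''Free_' n") : type_scope.

Section FreeProduct.
Variables G H : groupType.

Local Notation syllable := (G + H)%type.

Implicit Types (a b c : syllable) (u v w : seq syllable).

Definition strivial a : bool :=
  match a with inl x => x == 1 | inr y => y == 1 end.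

Definition is_left a : bool := if a is inl _ then true else false.

Definition sinv a : syllable :=
  match a with inl x => inl x^-1 | inr y => inr y^-1 end.

Definition smul a b : option syllable :=
  match a, b with
  | inl x, inl y => Some (inl (x * y))
  | inr x, inr y => Some (inr (x * y))
  | _, _ => None
  end.

Definition normal_form w : bool :=
  all (fun a => ~~ strivial a) w &&
  sorted (fun a b => is_left a != is_left b) w.

(* the normal form of a :: w, for w in normal form *)
Definition spush a w : seq syllable :=
  if strivial a then w else
  if w is b :: w' then
    if smul a b is Some c then if strivial c then w' else c :: w'
    else a :: w
  else [:: a].

Definition nf_mul u v : seq syllable := foldr spush v u.
Definition nf_inv u : seq syllable := rev (map sinv u).

Lemma sinvK : involutive sinv.
Proof. by case=> x /=; rewrite invgK. Qed.

Lemma strivial_inv a : strivial (sinv a) = strivial a.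
Proof. by case: a => x /=; rewrite invg_eq1. Qed.

Lemma is_left_inv a : is_left (sinv a) = is_left a.
Proof. by case: a. Qed.

Lemma nf_tail a w : normal_form (a :: w) -> normal_form w.
Proof. by case/andP=> /= /andP[_ nw] /path_sorted sw; apply/andP. Qed.

Lemma smul_side a b c :
  smul a b = Some c -> is_left a = is_left b /\ is_left c = is_left b.
Proof. by case: a b => x [] y //= [<-]. Qed.

Lemma smul_alt a b : smul a b = None -> is_left a != is_left b.
Proof. by case: a b => x [] y. Qed.

Lemma smul_None a b : is_left a != is_left b -> smul a b = None.
Proof. by case: a b => x [] y. Qed.

Lemma smulA a b c d e : smul a b = Some c -> smul b d = Some e ->
  exists2 f, smul a e = Some f & smul c d = Some f.
Proof.
by case: a b d => x [] y [] z //= [<-] [<-];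
  [exists (inl (x * y * z))|exists (inr (x * y * z))] => //=; rewrite mulgA.
Qed.

Lemma smul1s a b c : smul a b = Some c -> strivial a -> c = b.
Proof. by case: a b => x [] y //= [<-] /eqP->; rewrite mul1g. Qed.

Lemma smuls1 a b c : smul a b = Some c -> strivial b -> c = a.
Proof. by case: a b => x [] y //= [<-] /eqP->; rewrite mulg1. Qed.

Lemma smul_inv a : exists2 c, smul (sinv a) a = Some c & strivial c.
Proof.
by case: a => x; [exists (inl 1)|exists (inr 1)]; rewrite /= ?mulVg.
Qed.

Lemma nf_head a b w : normal_form (b :: w) -> ~~ strivial a ->
  is_left a = is_left b -> normal_form (a :: w).
Proof.
case/andP=> /= /andP[_ aw] sw na eab; rewrite /normal_form /= na aw.
by case: (w) sw => //= d s; rewrite eab.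
Qed.

Lemma spush_nf a w : normal_form w -> normal_form (spush a w).
Proof.
rewrite /spush; case: ifPn => // na; case: w => [|b w] nw.
  by rewrite /normal_form /= na.
case E: (smul a b) => [c|]; last first.
  by case/andP: nw => /= nw sw; rewrite /normal_form /= na nw smul_alt.
case: ifPn => nc; first exact: nf_tail nw.
exact: nf_head nw nc (smul_side E).2.
Qed.

Lemma spush1 a w : strivial a -> spush a w = w.
Proof. by rewrite /spush => ->. Qed.

Lemma spush_cons a w : normal_form (a :: w) -> spush a w = a :: w.
Proof.
case/andP=> /= /andP[na _]; rewrite /spush (negPf na).
by case: w => //= b w /andP[/smul_None->].
Qed.

Lemma spush_mul a b c w : normal_form w -> smul a b = Some c ->
  spush a (spush b w) = spush c w.
Proof.
move=> nw E; have [tb|nb] := boolP (strivial b).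
  by rewrite (spush1 _ tb) (smuls1 E tb).
have [ta|na] := boolP (strivial a).
  by rewrite (spush1 _ ta) (smul1s E ta).
case: w nw => [|d w] nw.
  by rewrite /spush (negPf nb) (negPf na) E.
case Ebd: (smul b d) => [e|]; last first.
  rewrite {2}/spush (negPf nb) Ebd /spush (negPf na) E.
  case: ifPn => // nc; rewrite (smul_None (a := c)) //.
  by have [_ ->] := smul_side E; apply: smul_alt.
have [f Eae Ecd] := smulA E Ebd.
rewrite {2}/spush (negPf nb) Ebd; case: ifPn => [te|ne].
  move: Ecd; rewrite {f Eae}(smuls1 Eae te) => Ead.
  have [_ sad] := smul_side Ead.
  rewrite spush_cons; last exact: nf_head nw na sad.
  rewrite /spush Ead (negPf na); case: ifPn => // tc.
  by rewrite (smul1s Ead tc).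
rewrite /spush (negPf na) Eae Ecd; case: (ifPn (strivial c)) => // tc.
by rewrite (smul1s Ecd tc); case/andP: nw => /= /andP[/negPf->].
Qed.

Lemma nf_mul_nf u v : normal_form v -> normal_form (nf_mul u v).
Proof. by move=> nv; elim: u => //= a u; apply: spush_nf. Qed.

Lemma nf_mul_push a u v : normal_form u -> normal_form v ->
  nf_mul (spush a u) v = spush a (nf_mul u v).
Proof.
move=> nu nv; have [ta|na] := boolP (strivial a); first by rewrite !spush1.
case: u nu => [|b u] nu; first by rewrite {1}/spush (negPf na).
rewrite {1}/spush (negPf na) /=; case E: (smul a b) => [c|] //=.
rewrite (spush_mul _ E); last exact: nf_mul_nf.
by case: ifPn => // tc; rewrite spush1.
Qed.

Lemma nf_mulA u v w : normal_form v -> normal_form w ->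
  nf_mul u (nf_mul v w) = nf_mul (nf_mul u v) w.
Proof.
move=> nv nw; elim: u => //= a u ->.
by rewrite nf_mul_push //; apply: nf_mul_nf.
Qed.

Lemma nf_mul1 u : normal_form u -> nf_mul u [::] = u.
Proof.
by elim: u => //= a u IHu nu; rewrite IHu ?spush_cons //; apply: nf_tail nu.
Qed.

Lemma nf_inv_nf u : normal_form u -> normal_form (nf_inv u).
Proof.
case/andP=> nu su; rewrite /normal_form /nf_inv all_rev all_map rev_sorted.
rewrite sorted_map; apply/andP; split.
  by apply: sub_all nu => a; rewrite /= strivial_inv.
rewrite (@eq_sorted _ _ (fun a b => is_left a != is_left b)) // => a b.
by rewrite /= !is_left_inv eq_sym.
Qed.

Lemma nf_mulV u : normal_form u -> nf_mul (nf_inv u) u = [::].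
Proof.
elim: u => // a u IHu nu; rewrite /nf_inv /= rev_cons /nf_mul foldr_rcons.
have nu' := nf_tail nu; have [c E tc] := smul_inv a.
by rewrite -(spush_cons nu) (spush_mul nu' E) (spush1 _ tc); apply: IHu.
Qed.

Lemma nf_invK : involutive nf_inv.
Proof. by move=> u; rewrite /nf_inv map_rev revK mapK //; apply: sinvK. Qed.

Record freeProduct : Type := FreeProduct {
  nform : seq syllable;
  _ : normal_form nform
}.

HB.instance Definition _ := [isSub for nform].
HB.instance Definition _ := [Choice of freeProduct by <:].

Lemma nformP (g : freeProduct) : normal_form (nform g). Proof. exact: valP. Qed.

Definition fprod_one : freeProduct := @FreeProduct [::] isT.
Definition fprod_mul (g h : freeProduct) : freeProduct :=
  FreeProduct (nf_mul_nf (nform g) (nformP h)).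
Definition fprod_inv (g : freeProduct) : freeProduct :=
  FreeProduct (nf_inv_nf (nformP g)).

Lemma fprod_mulA : associative fprod_mul.
Proof. by move=> g h k; apply/val_inj/nf_mulA; apply: nformP. Qed.
Lemma fprod_mul1g : left_id fprod_one fprod_mul.
Proof. by move=> g; apply/val_inj. Qed.
Lemma fprod_mulg1 : right_id fprod_one fprod_mul.
Proof. by move=> g; apply/val_inj/nf_mul1/nformP. Qed.
Lemma fprod_mulVg : left_inverse fprod_one fprod_inv fprod_mul.
Proof. by move=> g; apply/val_inj/nf_mulV/nformP. Qed.
Lemma fprod_mulgV : right_inverse fprod_one fprod_inv fprod_mul.
Proof.
by move=> g; rewrite -{1}[g](_ : fprod_inv (fprod_inv g) = g) ?fprod_mulVg //;
  apply/val_inj/nf_invK.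
Qed.

HB.instance Definition _ := isGroup.Build freeProduct
  fprod_mulA fprod_mul1g fprod_mulg1 fprod_mulVg fprod_mulgV.

Definition fprod_inl (x : G) : freeProduct :=
  FreeProduct (spush_nf (inl x) (isT : normal_form [::])).
Definition fprod_inr (y : H) : freeProduct :=
  FreeProduct (spush_nf (inr y) (isT : normal_form [::])).

Lemma fprod_inl_morph : {morph fprod_inl : x y / x * y}.
Proof.
move=> x y; apply/val_inj => /=; rewrite nf_mul_push ?spush_nf //.
exact/esym/spush_mul.
Qed.

Lemma fprod_inr_morph : {morph fprod_inr : x y / x * y}.
Proof.
move=> x y; apply/val_inj => /=; rewrite nf_mul_push ?spush_nf //.
exact/esym/spush_mul.
Qed.

Lemma fprod_inl1 : fprod_inl 1 = 1.
Proof. by apply/val_inj/spush1/eqxx. Qed.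
Lemma fprod_inr1 : fprod_inr 1 = 1.
Proof. by apply/val_inj/spush1/eqxx. Qed.

HB.instance Definition _ := isUMagmaMorphism.Build G freeProduct fprod_inl
  (conj fprod_inl1 fprod_inl_morph).
HB.instance Definition _ := isUMagmaMorphism.Build H freeProduct fprod_inr
  (conj fprod_inr1 fprod_inr_morph).

End FreeProduct.

Section Subgroups.
Variable G : groupType.
Implicit Types (A H : set G).

Definition subgroup H : Prop := group_closed [in H].

Lemma subgroupP H :
  subgroup H <-> H 1 /\ (forall x y, H x -> H y -> H (x / y)).
Proof.
split=> -[H1 HF]; split.
- exact: set_mem.
- by move=> x y /mem_set Hx /mem_set Hy; apply/set_mem/HF.
- exact: mem_set.
- by move=> x y /set_mem Hx /set_mem Hy; apply/mem_set/HF.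
Qed.

Definition generated A : set G := smallest subgroup A.

Definition fin_gen H : Prop := exists2 A, finite_set A & generated A = H.

(* H is free with a basis of n elements: some map b from 'I_n to G extends to
   an isomorphism from the free group of rank n onto H. *)
Definition free_of_rank H (n : nat) : Prop :=
  exists2 b : 'I_n -> G,
    injective (free_lift b) & range (free_lift b) = H.

Lemma free_of_rank_leq H n m : free_of_rank H n -> free_of_rank H m -> m <= n.
Proof.
move=> [b binj bH] [c cinj cH].
have ex g : exists h, free_lift c h = free_lift b g.
  have: H (free_lift b g) by rewrite -bH; exists g.
  by rewrite -cH => -[h _]; exists h.
pose phi g := projT1 (cid (ex g)).
have phiE g : free_lift c (phi g) = free_lift b g by rewrite /phi; case: cid.
have phiM : {morph phi : g h / g * h}.
  by move=> g h; apply: cinj; rewrite phiE !free_lift_morph !phiE.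
have phi_surj h : exists g, phi g = h.
  have: H (free_lift c h) by rewrite -cH; exists h.
  by rewrite -bH => -[g _ e]; exists g; apply: cinj; rewrite phiE.
pose Z2 := Algebra.to_multiplicative 'Z_2.
pose L (e : {ffun 'I_m -> 'Z_2}) : freeGroup 'I_m -> Z2 :=
  free_lift (fun i => e i : Z2).
pose T (e : {ffun 'I_m -> 'Z_2}) : {ffun 'I_n -> 'Z_2} :=
  [ffun i => L e (phi (free_gen i))].
have Tinj : injective T.
  move=> e e' /ffunP eT; apply/ffunP => i.
  have LM d : {morph L d \o phi : g h / g * h}.
    by move=> g h; rewrite /= phiM /L free_lift_morph.
  have eL g : (L e \o phi) g = (L e' \o phi) g.
    rewrite (morph_free_lift (LM e)) (morph_free_lift (LM e')).
    apply: eq_bigr => a _ /=; have := eT a.1; rewrite !ffunE => -> //.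
  have [g eg] := phi_surj (free_gen i).
  by have := eL g; rewrite /= eg /L !free_lift_gen.
have := leq_card T Tinj; rewrite !card_ffun !card_ord /=.
by rewrite leq_exp2l.
Qed.

Lemma free_of_rank_inj H n m : free_of_rank H n -> free_of_rank H m -> n = m.
Proof.
by move=> Hn Hm; apply/eqP; rewrite eqn_leq !(@free_of_rank_leq H).
Qed.

(* None stands for infinity. If H is a subgroup of a free group, it is free by
   Nielsen-Schreier, so it has no finite basis only if its rank is infinite. *)
Definition rank H : option nat :=
  if pselect (exists n, free_of_rank H n) is left ex
  then Some (projT1 (cid ex)) else None.

Lemma rankE H n : free_of_rank H n -> rank H = Some n.
Proof.
move=> Hn; rewrite /rank; case: pselect => [ex|[]]; last by exists n.
by congr Some; apply: free_of_rank_inj (projT2 (cid ex)) Hn.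
Qed.

End Subgroups.

Definition min_rank (r s : option nat) : option nat :=
  match r, s with
  | Some m, Some n => Some (minn m n)
  | None, _ => s
  | _, None => r
  end.

Definition free_abelian (m : nat) : groupType :=
  Algebra.to_multiplicative 'rV[int]_m.

Definition FxZ (n m : nat) : groupType := ('Free_n * free_abelian m)%type.

Section StronglyComplementaryProduct.
Variables n1 m1 n2 m2 : nat.

Definition scprod : groupType :=
  (freeProduct 'Free_n1 'Free_n2 *
   Algebra.to_multiplicative ('rV[int]_m1 * 'rV[int]_m2))%type.

Definition scprod_inl (g : FxZ n1 m1) : scprod :=
  (fprod_inl _ g.1, (g.2, 0%R)).
Definition scprod_inr (g : FxZ n2 m2) : scprod :=
  (fprod_inr _ g.1, (0%R, g.2)).

Lemma scprod_inl_morph : {morph scprod_inl : g h / g * h}.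
Proof.
by move=> g h; rewrite /scprod_inl gmulfM; do 2?congr pair; rewrite addr0.
Qed.

Lemma scprod_inr_morph : {morph scprod_inr : g h / g * h}.
Proof.
by move=> g h; rewrite /scprod_inr gmulfM; do 2?congr pair; rewrite addr0.
Qed.

Definition scjoin (H1 : set (FxZ n1 m1)) (H2 : set (FxZ n2 m2)) : set scprod :=
  generated (scprod_inl @` H1 `|` scprod_inr @` H2).

End StronglyComplementaryProduct.

(* Main.v *)
Require Import Defs.
From HB Require Import structures.
From mathcomp Require Import all_boot all_order all_algebra.
From mathcomp Require Import boolp classical_sets functions cardinality.
From mathcomp Require Import zify.

(** Write A' for the intersection of the projections of the H'_j to the free
    part, and B' for the projection of their intersection; similarly A'' and
    B''. The lift of an element of the free part of H'_j to H'_j is unique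
    up to the abelian part, which is central; this makes B' a normal
    subgroup of A' that contains all the commutators of A'
    ([proj_bigcap_normal], [proj_bigcap_commutator]).

    Normal forms in the free product show that the intersection K of the
    joins <H'_j, H''_j> consists of the elements whose free part lies in
    A' * A'' and whose two projections, to G' and to G'', lie in the
    intersection of the H'_j and in that of the H''_j ([bigcap_scjoinE]).
    Both intersections are therefore retracts of K, which gives the direct
    implication.

    For the converse, suppose that both intersections are finitely
    generated. If A' or A'' is trivial, the two intersections together
    generate K ([fin_gen_subjoin_trivial]). Otherwise neither rank is 0 or
    1. As an abelian subgroup of a free group is trivial or infinite cyclic
    ([free_of_rank_abelian]), A' is not abelian, so B' is nontrivial. A
    nontrivial finitely generated subgroup of a free group has finite index
    in any subgroup that normalises it ([finite_index_of_normal]), so B' has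
    finite index in A', and likewise B'' in A''. Hence A' and A'' are
    finitely generated, and so is A' * A''; the free part of K is the kernel
    of the map from A' * A'' to the product of the finite groups A' / B' and
    A'' / B'', so it is finitely generated by Schreier's lemma
    ([fin_gen_finite_index]), and K is an extension of it by an abelian part
    that already comes from the two intersections
    ([fin_gen_subjoin_of_proj]).

    The finite index theorem and the theorem on abelian subgroups are proved
    by cancellation arguments on reduced words, which say that geodesics of
    the Cayley tree between elements of a finitely generated subgroup stay
    near that subgroup ([near_prefix], [minimal_representative_near]). *)

Set Implicit Arguments.
Unset Strict Implicit.
Unset Printing Implicit Defensive.

Local Open Scope classical_set_scope.
Local Open Scope group_scope.

(** * Subgroups and finite generation *)

Section SubgroupTheory.
Context {G : groupType}.
Implicit Types (A B H S T : set G) (x y : G).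

Lemma subgroup1 H : subgroup H -> H 1.
Proof. by case/subgroupP. Qed.

Lemma subgroupF H x y : subgroup H -> H x -> H y -> H (x / y).
Proof. by case/subgroupP => _; apply. Qed.

Lemma subgroupV H x : subgroup H -> H x -> H x^-1.
Proof. by move=> sH Hx; rewrite -div1g; apply: subgroupF (subgroup1 sH) Hx. Qed.

Lemma subgroupM H x y : subgroup H -> H x -> H y -> H (x * y).
Proof.
by move=> sH Hx Hy; rewrite -[y]invgK; apply: subgroupF Hx (subgroupV sH Hy).
Qed.

Lemma subgroupX H x n : subgroup H -> H x -> H (x ^+ n).
Proof.
move=> sH Hx; elim: n => [|n IHn]; first exact: subgroup1.
by rewrite expgS; apply: subgroupM.
Qed.

Lemma subgroupI H K : subgroup H -> subgroup K -> subgroup (H `&` K).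
Proof.
move=> sH sK; apply/subgroupP; split; first by split; apply: subgroup1.
by move=> x y [Hx Kx] [Hy Ky]; split; apply: subgroupF.
Qed.

Lemma subgroup_bigcap I (P : set I) (F : I -> set G) :
  (forall i, P i -> subgroup (F i)) -> subgroup (\bigcap_(i in P) F i).
Proof.
move=> sF; apply/subgroupP; split; first by move=> i /sF/subgroup1.
by move=> x y Fx Fy i Pi; apply: subgroupF (sF i Pi) (Fx i Pi) (Fy i Pi).
Qed.

Lemma generated_subgroup S : subgroup (generated S).
Proof. by apply: subgroup_bigcap => H []. Qed.

Lemma sub_generated S : S `<=` generated S.
Proof. exact: sub_gen_smallest. Qed.

Lemma generated_min H S : subgroup H -> S `<=` H -> generated S `<=` H.
Proof. exact: smallest_sub. Qed.

Lemma generatedS S T : S `<=` T -> generated S `<=` generated T.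
Proof.
move=> ST; apply: generated_min; first exact: generated_subgroup.
exact: subset_trans ST (@sub_generated T).
Qed.

Lemma generated_ind S (P : G -> Prop) : P 1 ->
  (forall x s, S s -> P x -> P (x * s) /\ P (x / s)) ->
  forall x, generated S x -> P x.
Proof.
move=> P1 PS x Sx.
(* the elements whose right translation preserves P form a subgroup *)
pose Q : set G := [set y | forall z, P z <-> P (z * y)].
have sQ : subgroup Q.
  apply/subgroupP; split=> [z|y y' Qy Qy' z]; first by rewrite mulg1.
  by rewrite (Qy z) mulgA -{1}[z * y](mulgVK y') -Qy'.
suff /(_ x Sx 1) : generated S `<=` Q by rewrite mul1g => -[/(_ P1)].
apply: generated_min => // s Ss z; split=> [/(PS _ _ Ss)[]//|].
by move/(PS _ _ Ss) => [_]; rewrite mulgK.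
Qed.

Lemma fin_gen_generated S : finite_set S -> fin_gen (generated S).
Proof. by exists S. Qed.

Lemma fin_gen_subgroup H : fin_gen H -> subgroup H.
Proof. by case=> S _ <-; apply: generated_subgroup. Qed.

Lemma fin_gen_between S H : finite_set S -> subgroup H -> S `<=` H ->
  H `<=` generated S -> fin_gen H.
Proof.
move=> fS sH SH HS; exists S => //; apply/seteqP; split=> //.
exact: generated_min.
Qed.

(** A representative t = b^-1 a of a coset that meets A is itself in A. *)
Lemma cosets_inter {A B T} : subgroup A -> B `<=` A ->
  (forall a, A a -> exists b t, [/\ B b, T t & a = b * t]) ->
  forall a, A a -> exists b t, [/\ B b, (T `&` A) t & a = b * t].
Proof.
move=> sA BA AT a Aa; have [b [t [Bb Tt e]]] := AT a Aa.
exists b, t; split=> //; split=> //; rewrite -[t](mulKg b) -e.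
by apply: subgroupM => //; apply: subgroupV => //; apply: BA.
Qed.

Lemma fin_gen_cosets {A B T} : subgroup A -> fin_gen B -> B `<=` A ->
  finite_set T -> (forall a, A a -> exists b t, [/\ B b, T t & a = b * t]) ->
  fin_gen A.
Proof.
move=> sA [S fS SB] BA fT AT.
apply: (fin_gen_between (S := S `|` (T `&` A))) => //.
- rewrite finite_setU; split=> //; exact: sub_finite_set fT.
- move=> x [Sx|[]//]; apply/BA; rewrite -SB; exact: sub_generated.
move=> a Aa; have [b [t [Bb TAt ->]]] := cosets_inter sA BA AT Aa.
apply: (subgroupM (generated_subgroup _)).
  by apply: (generatedS (S := S)); [move=> ?; left|rewrite SB].
by apply: sub_generated; right.
Qed.

(** Schreier's lemma. The set T of coset representatives is not asked to be
    a transversal nor to contain 1: all the elements t s r^-1 that happen to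
    lie in N are taken as generators, so that no choice of the
    representative r of the coset of t s has to be made. *)
Lemma fin_gen_finite_index {N D T} : subgroup N -> fin_gen D -> N `<=` D ->
  finite_set T -> (forall x, D x -> exists n t, [/\ N n, T t & x = n * t]) ->
  fin_gen N.
Proof.
move=> sN [S fS SD] ND fT DT.
have sD : subgroup D by rewrite -SD; apply: generated_subgroup.
pose S' := S `|` [set s^-1 | s in S].
have fS' : finite_set S'.
  by rewrite finite_setU; split=> //; apply: finite_image.
(* the part T of Z serves for the t that lie in N themselves *)
pose Z := [set u.1.1 * u.1.2 / u.2 | u in (T `*` S') `*` T] `|` T.
have fZ : finite_set Z.
  rewrite finite_setU; split=> //; apply: finite_image.
  by do 2?[apply: finite_setX => //].
pose M := generated (Z `&` N).
have sM : subgroup M by apply: generated_subgroup.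
have MN : M `<=` N by apply: generated_min => // x [].
have DS' s : S' s -> D s.
  move=> [Ss|[t St <-]]; last apply: subgroupV => //.
    by rewrite -SD; apply: sub_generated.
  by rewrite -SD; apply: sub_generated.
(* M T contains 1 and is stable under right multiplication by S', so that it
   covers D; an element m t of it lies in N only if t does *)
have DMT x : D x -> D x /\ exists m t, [/\ M m, T t & x = m * t].
  rewrite -{1}SD; move: x; apply: generated_ind.
    split; first exact: subgroup1.
    have [n [t [Nn Tt e]]] := DT _ (subgroup1 sD).
    exists t^-1, t; rewrite mulVg; split=> //; apply: (subgroupV sM).
    apply: sub_generated; split; first by right.
    by rewrite -[t](mulKg n) -e mulg1; apply: subgroupV.
  have step x s : S' s -> D x /\ (exists m t, [/\ M m, T t & x = m * t]) ->
      D (x * s) /\ (exists m t, [/\ M m, T t & x * s = m * t]).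
    move=> S's [Dx [m [t [Mm Tt e]]]]; have Ds := DS' s S's.
    split; first exact: subgroupM.
    have Dt : D t.
      rewrite -[t](mulKg m) -e; apply: (subgroupM) => //.
      by apply: subgroupV => //; apply/ND/MN.
    have [n [r [Nn Tr e']]] := DT _ (subgroupM sD Dt Ds).
    exists (m * n), r; split=> //; last by rewrite e -!mulgA e'.
    apply: (subgroupM sM) => //; apply: sub_generated; split=> //.
    by left; exists ((t, s), r) => //=; rewrite e' mulgK.
  move=> x s Ss Px; split; apply: step => //; first by left.
  by right; exists s.
apply: (fin_gen_between (S := Z `&` N)) => //; first exact: sub_finite_set fZ.
move=> x Nx; have [_ [m [t [Mm Tt e]]]] := DMT x (ND _ Nx).
rewrite e; apply: (subgroupM sM) => //.
apply: sub_generated; split; first by right.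
rewrite -[t](mulKg m) -e; apply: (subgroupM) => //.
by apply: subgroupV => //; apply: MN.
Qed.

End SubgroupTheory.

Section Morphisms.
Context {G K : groupType} (f : UMagmaMorphism.type G K).

Lemma subgroup_image H : subgroup H -> subgroup (f @` H).
Proof.
move=> sH; apply/subgroupP; split.
  by exists 1; rewrite ?gmulf1 //; apply: subgroup1.
move=> _ _ [x Hx <-] [y Hy <-]; exists (x / y); last exact: gmulfF.
exact: subgroupF.
Qed.

Lemma subgroup_preimage H : subgroup H -> subgroup (f @^-1` H).
Proof.
move=> sH; apply/subgroupP; split; rewrite /preimage /=.
  by rewrite gmulf1; apply: subgroup1.
by move=> x y Hx Hy; rewrite gmulfF; apply: subgroupF.
Qed.

Lemma image_generated S : f @` generated S `<=` generated (f @` S).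
Proof.
move=> _ [x Sx <-].
suff: generated S `<=` f @^-1` generated (f @` S) by apply.
apply: generated_min.
  exact/subgroup_preimage/generated_subgroup.
by move=> s Ss; apply: sub_generated; exists s.
Qed.

Lemma fin_gen_image H : fin_gen H -> fin_gen (f @` H).
Proof.
case=> S fS SH; apply: (fin_gen_between (S := f @` S)).
- exact: finite_image.
- by apply: subgroup_image; rewrite -SH; apply: generated_subgroup.
- by move=> _ [s Ss <-]; exists s => //; rewrite -SH; apply: sub_generated.
- by rewrite -SH; apply: image_generated.
Qed.

(** H is generated by S and by lifts of generators of its image. In the
    application S generates a subgroup that covers the kernel without being
    contained in it. *)
Lemma fin_gen_extension H : subgroup H -> fin_gen (f @` H) ->
  (exists2 S, finite_set S & S `<=` H /\
    forall x, H x -> f x = 1 -> generated S x) ->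
  fin_gen H.
Proof.
move=> sH [R fR RH] [S fS [SH kerS]].
have lift y : exists x, R y -> H x /\ f x = y.
  case: (pselect (R y)) => Ry; last by exists 1.
  have: (f @` H) y by rewrite -RH; apply: sub_generated.
  by case=> x Hx e; exists x.
have [g gP] := choice lift.
pose U := S `|` g @` R.
have sU : subgroup (generated U) by apply: generated_subgroup.
have UH : U `<=` H by move=> x [/SH//|[y /gP[Hgy _] <-]].
apply: (fin_gen_between (S := U)) => //.
  by rewrite finite_setU; split=> //; apply: finite_image.
move=> x Hx; have: (f @` H) (f x) by exists x.
rewrite -RH => Rfx.
have [y Uy e] : (f @` generated U) (f x).
  suff: generated R `<=` f @` generated U by apply.
  apply: generated_min; first exact: subgroup_image.
  move=> y Ry; exists (g y); last by have [] := gP y Ry.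
  by apply: sub_generated; right; exists y.
rewrite -[x](mulgVK y); apply: (subgroupM sU) => //.
apply: (generatedS (S := S)); first by move=> ?; left.
apply: kerS; last by rewrite gmulfF e mulgV.
by apply: subgroupF => //; apply: generated_min Uy.
Qed.

End Morphisms.

(** * Reduced words and cancellation *)

Section Words.
Context {X : choiceType}.
Local Notation word := (seq (X * bool)).
Local Notation F := (freeGroup X).
Implicit Types (u v w : word) (g h a b : F).

Definition of_word w : F := FreeGroup (word_mul_reduced w (isT : reduced [::])).

Definition len g : nat := size (fword g).

Lemma of_word_nil : of_word [::] = 1.
Proof. exact/val_inj. Qed.

Lemma of_word_cat u v : of_word (u ++ v) = of_word u * of_word v.
Proof.
apply/val_inj => /=; rewrite /word_mul foldr_cat.
exact: (word_mulA u (isT : reduced [::])) (word_mul_reduced v _).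
Qed.

Lemma of_wordK g : of_word (fword g) = g.
Proof. by apply/val_inj/word_mul1/fwordP. Qed.

Lemma of_word_inv w : of_word (word_inv w) = (of_word w)^-1.
Proof.
elim: w => [|a w IHw]; first by rewrite of_word_nil invg1 -of_word_nil.
rewrite -cat1s /word_inv map_cat rev_cat !of_word_cat invgM -IHw; congr (_ * _).
by apply/val_inj.
Qed.

Lemma word_inv_cat u v : word_inv (u ++ v) = word_inv v ++ word_inv u.
Proof. by rewrite /word_inv map_cat rev_cat. Qed.

Lemma size_word_inv w : size (word_inv w) = size w.
Proof. by rewrite size_rev size_map. Qed.

Lemma lenV g : len g^-1 = len g.
Proof. exact: size_word_inv. Qed.

Lemma len0 g : len g = 0%N -> g = 1.
Proof. by move/size0nil => e; apply/val_inj. Qed.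

Lemma len_of_word w : (len (of_word w) <= size w)%N.
Proof.
elim: w => //= a w; rewrite /len /= -/(word_mul w [::]) => IHw.
case: (word_mul w [::]) IHw => [|b v] //=; case: eqP => _ //=.
by move/ltnW/leqW.
Qed.

(** In a product of two reduced words the letters that disappear are a
    suffix of the first word and the inverse prefix of the second. In the
    Cayley tree, u is the branch point of the geodesics from 1 to g and from
    1 to g h. *)
Lemma cancellation g h : exists u c v,
  [/\ fword g = u ++ c, fword h = word_inv c ++ v & fword (g * h) = u ++ v].
Proof.
change (fword (g * h)) with (word_mul (fword g) (fword h)).
elim: (fword g) (fwordP g) => [|a w IHw] rw.
  by exists [::], [::], (fword h).
have [u [c [v [ew eh em]]]] := IHw (reduced_tail rw).
rewrite /= -/(word_mul w (fword h)) em; case: u => [|x u] in ew em *.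
  case: v => [|y v] in eh em *; first by exists [:: a], c, [::]; rewrite ew.
  rewrite /=; case: eqVneq => [ey|_]; last first.
    by exists [:: a], c, (y :: v); rewrite ew.
  exists [::], (a :: c), v; rewrite ew eh; split=> //.
  by rewrite -[a :: c]cat1s word_inv_cat -catA ey.
exists (a :: x :: u), c, v; rewrite ew; split=> //=.
by move: rw; rewrite ew /= => /andP[/negPf->].
Qed.

(** Were half of g or more cancelled in g g, the prefix c^-1 and the suffix
    c would cover g, and the two letters in the middle of g would be inverse
    to each other, or the middle letter to itself. *)
Lemma len_mul_sqr g : g <> 1 -> (len g < len (g * g)%g)%N.
Proof.
move=> g1; have [u [c [v [eg eg' e2]]]] := cancellation g g.
have gt0 : (0 < len g)%N by rewrite lt0n; apply: contra_notN g1 => /eqP/len0.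
rewrite ltnNge; apply/negP => le2.
have szg : len g = (size u + size c)%N by rewrite /len eg size_cat.
have szg' : len g = (size c + size v)%N.
  by rewrite /len eg' size_cat size_word_inv.
have sz2 : len (g * g) = (size u + size v)%N by rewrite /len e2 size_cat.
have letterE j : (j < size c)%N -> forall x0,
    nth x0 (fword g) j = linv (nth x0 (fword g) (len g - j.+1)).
  move=> jc x0; rewrite {1}eg' eg !nth_cat size_word_inv jc.
  rewrite ltnNge szg (_ : size u <= _)%N /=; last by lia.
  rewrite /word_inv nth_rev ?size_map // (nth_map x0); last by lia.
  congr (linv (nth _ _ _)); lia.
(* j is the middle position, or the left one of the two middle positions *)
pose j := (len g).-1./2.
have jc : (j < size c)%N by rewrite /j; lia.
have x0 : X * bool by move: gt0; rewrite /len; case: (fword g).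
have := letterE j jc x0.
have [e|e] : (len g - j.+1 = j \/ len g - j.+1 = j.+1)%N by rewrite /j; lia.
  by rewrite e => /(congr1 snd) /=; case: (_.2).
rewrite e => ej.
have := fwordP g; rewrite /reduced => /(sortedP x0)/(_ j).
rewrite -/(len g) ej linvK eqxx => /(_ _)/negP; apply=> //.
by rewrite /j; lia.
Qed.

End Words.

(** * Finite index of normal subgroups of free groups *)

Section FreeGroupGeometry.
Context {X : choiceType}.
Local Notation F := (freeGroup X).
Implicit Types (g h a b : F) (A B S : set F).

Lemma len_mul g h : (len (g * h)%g <= len g + len h)%N.
Proof.
by rewrite -{1}[g]of_wordK -{1}[h]of_wordK -of_word_cat -size_cat len_of_word.
Qed.

Lemma len_exp g n : (len (g ^+ n)%g <= n * len g)%N.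
Proof.
elim: n => [|n IHn]; first by rewrite expg0.
by rewrite expgS mulSn; apply: leq_trans (len_mul _ _) _; rewrite leq_add2l.
Qed.

(** The lengths of the elements g ^ (2 ^ i) grow strictly, whereas the
    powers of an element of finite order have bounded length. *)
Lemma free_torsion_free g n : (0 < n)%N -> (g ^+ n)%g = 1 -> g = 1.
Proof.
move=> n0 gn1; apply: contrapT => g1.
have powers i : (i < len (g ^+ (2 ^ i)%N)%g)%N.
  elim: i => [|i IHi].
    by rewrite expg1 lt0n; apply: contra_notN g1 => /eqP/len0.
  rewrite expnSr expgnA expg2; apply: leq_trans (len_mul_sqr _) => // e.
  by rewrite e in IHi.
have := powers (n * len g)%N; apply/negP; rewrite -leqNgt.
set m := (2 ^ _)%N; rewrite (divn_eq m n) expgnDr mulnC expgnA gn1 expg1n mul1g.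
apply: leq_trans (len_exp _ _) _; rewrite leq_mul2r; apply/orP; right.
by apply/ltnW; rewrite ltn_mod.
Qed.

(** Quasi-convexity of a subgroup B generated by elements of length at most
    R: the geodesic from 1 to an element of B stays at distance at most R
    from B. The geodesic to h s consists of a part of the geodesic to h,
    then of a part of the geodesic from h to h s, which has length at most
    R. *)
Lemma near_prefix S (R : nat) : (forall s, S s -> (len s <= R)%N) ->
  forall h, generated S h -> forall p q, fword h = p ++ q ->
  exists2 b, generated S b & (len (b^-1 * of_word p)%g <= R)%N.
Proof.
move=> SR; have sB := generated_subgroup S.
pose near h := forall p q, fword h = p ++ q ->
  exists2 b, generated S b & (len (b^-1 * of_word p)%g <= R)%N.
have step h s : (len s <= R)%N -> generated S h -> near h -> near (h * s).
  move=> sR Bh nh p q; have [u [c [v [eh es ->]]]] := cancellation h s.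
  case: (leqP (size p) (size u)) => [pu /(congr1 (take (size p)))|/ltnW up].
    rewrite takel_cat // (take_size_cat q) // => ep.
    apply: (nh p (drop (size p) u ++ c)).
    by rewrite eh catA -{1}ep cat_take_drop.
  move=> e; have {}e : p = u ++ take (size p - size u) v.
    have := congr1 (take (size p)) e; rewrite (take_size_cat q) //.
    by rewrite take_cat ltnNge up.
  exists h => //; rewrite e -[h]of_wordK eh !of_word_cat invgM !mulgA mulgVK.
  rewrite -of_word_inv -of_word_cat; apply: leq_trans (len_of_word _) _.
  rewrite size_cat; apply: leq_trans sR.
  rewrite /len es size_cat leq_add2l size_take.
  by case: ltnP => // /ltnW.
move=> h Bh; suff: generated S h /\ near h by case.
move: h Bh; apply: generated_ind.
  split; first exact: (subgroup1 sB).
  move=> [|? ?] q // _; exists 1; first exact: (subgroup1 sB).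
  by rewrite invg1 mul1g.
move=> x s Ss [Bx nx]; have Bs := sub_generated Ss.
split; split; first exact: (subgroupM sB).
- by apply: step => //; apply: SR.
- exact: (subgroupF sB).
- by apply: step => //; rewrite lenV; apply: SR.
Qed.

(** The heart of the finite index theorem. When a has minimal length in its
    coset B a = a B, multiplying a on the right by b0 / a cancels at most
    len b0 letters of a: with more cancellation, the part b1 of b0 that is
    kept in b0 / a and the inverse of the part e that is cancelled would
    both be prefixes of a^-1, of the same length by minimality, so that b0 =
    b1 e = 1. So a long prefix u of a survives in the element a b0 a^-1 of
    B, and hence u, and with it a, is near B. *)
Lemma minimal_representative_near B (b0 : F) (R : nat) :
  (forall h, B h -> forall p q, fword h = p ++ q ->
     exists2 b, B b & (len (b^-1 * of_word p)%g <= R)%N) ->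
  subgroup B -> B b0 -> b0 <> 1 ->
  forall a, (forall b, B b -> B (b ^ a) /\ B (b ^ a^-1)) ->
  (forall b, B b -> (len a <= len (b * a)%g)%N) ->
  exists2 b, B b & (len (b * a)%g <= R + len b0)%N.
Proof.
move=> nearB sB Bb0 b0n1 a normB mina.
have minar b : B b -> (len a <= len (a * b)%g)%N.
  move=> Bb; rewrite [(a * b)%g](_ : _ = (b ^ a^-1) * a)%g.
    by apply: mina; case: (normB b Bb).
  by rewrite conjgE invgK mulgA mulgVK.
have [b1 [e [z [eb ea ey]]]] := cancellation b0 a^-1.
have [u [c [v [ea' ey' ew]]]] := cancellation a (b0 / a).
have szb0 : len b0 = (size b1 + size e)%N by rewrite /len eb size_cat.
have ebg : b0 = of_word b1 * of_word e by rewrite -of_word_cat -eb of_wordK.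
have cb1 : (size c <= size b1)%N.
  rewrite leqNgt; apply/negP => /ltnW b1c.
  have := congr1 (take (size b1)) ey.
  rewrite ey' (take_size_cat z) // takel_cat ?size_word_inv // => eb1.
  have [s es] : exists s, fword a^-1 = b1 ++ s.
    exists (drop (size b1) (word_inv c) ++ word_inv u).
    by rewrite catA -{1}eb1 cat_take_drop -word_inv_cat -ea'.
  have sza : len a = (size e + size z)%N.
    by rewrite -lenV /len ea size_cat size_word_inv.
  have sza' : len a = (size b1 + size s)%N by rewrite -lenV /len es size_cat.
  (* minimality of a against a b0^-1 *)
  have le1 : (len a <= size b1 + size z)%N.
    have -> : (size b1 + size z)%N = len (a / b0).
      by rewrite -size_cat -ey -[RHS]lenV invgF.
    by apply: minar; apply: subgroupV.
  (* minimality of a against a b0 *)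
  have le2 : (len a <= size e + size s)%N.
    apply: leq_trans (minar _ Bb0) _; rewrite -[X in (X <= _)%N]lenV invgM.
    rewrite -[a^-1]of_wordK es of_word_cat ebg invgM mulgA mulgVK.
    rewrite -of_word_inv -of_word_cat; apply: leq_trans (len_of_word _) _.
    by rewrite size_cat size_word_inv.
  apply: b0n1; rewrite ebg.
  have : word_inv e ++ z == b1 ++ s by rewrite -ea -es.
  rewrite eqseq_cat ?size_word_inv; last first.
    apply/eqP; rewrite eqn_leq -(leq_add2r (size z)) -sza le1.
    by rewrite -(leq_add2r (size s)) -sza' le2.
  by case/andP=> /eqP <- _; rewrite of_word_inv mulVg.
have Bw : B (a * (b0 / a)).
  by have [_] := normB _ Bb0; rewrite conjgE invgK.
have [b Bb nb] := nearB _ Bw _ _ ew.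
exists b^-1; first exact: subgroupV.
rewrite -[a]of_wordK ea' of_word_cat mulgA; apply: leq_trans (len_mul _ _) _.
apply: leq_add => //; apply: leq_trans (len_of_word _) _.
by rewrite szb0; apply: leq_trans cb1 _; apply: leq_addr.
Qed.

End FreeGroupGeometry.

Lemma finite_ball (X : finType) (R : nat) :
  finite_set [set g : freeGroup X | (len g <= R)%N].
Proof.
pose f (s : R.-bseq (X * bool)) : freeGroup X := of_word s.
apply: (@sub_finite_set _ _ (range f)); last exact/finite_image/finite_finset.
by move=> g /= gR; exists (Bseq gR) => //; rewrite /f /= of_wordK.
Qed.

(** Representatives of minimal length of the cosets of B in A are near B,
    hence of bounded length by minimality, and over a finite alphabet a ball
    is finite. *)
Lemma finite_index_of_normal (X : finType) (A B : set (freeGroup X)) :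
  subgroup A -> B `<=` A -> (forall a b, A a -> B b -> B (b ^ a)) ->
  fin_gen B -> (exists2 b, B b & b <> 1) ->
  exists2 T, finite_set T &
    forall a, A a -> exists b t, [/\ B b, T t & a = b * t].
Proof.
move=> sA BA normB fgB [b0 Bb0 b0n1]; have sB := fin_gen_subgroup fgB.
have [S fS SB] := fgB.
have [R SR] : exists R, forall s, S s -> (len s <= R)%N.
  have /finite_seqP[r ->] := fS; exists (\max_(s <- r) len s)%N => s /= sr.
  exact: leq_bigmax_seq.
have near := near_prefix SR; rewrite SB in near.
exists [set g | (len g <= R + len b0)%N]; first exact: finite_ball.
move=> a; have [n] := ubnP (len a); elim: n a => // n IHn a an Aa.
have [[b Bb ba]|nmin] := pselect (exists2 b, B b & (len (b * a)%g < len a)%N).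
  have [||b' [t [Bb' tR e]]] := IHn (b * a).
  - exact: leq_trans ba _.
  - by apply: subgroupM => //; apply: BA.
  exists (b^-1 * b'), t; split=> //.
    by apply: subgroupM => //; apply: subgroupV.
  by rewrite -mulgA -e mulKg.
have normBa b : B b -> B (b ^ a) /\ B (b ^ a^-1).
  by move=> Bb; split; apply: normB => //; exact: subgroupV.
have [b Bb|b Bb le] := minimal_representative_near near sB Bb0 b0n1 normBa.
  by rewrite leqNgt; apply/negP => ba; apply: nmin; exists b.
exists b^-1, (b * a); split=> //; first exact: subgroupV.
by rewrite mulKg.
Qed.

(** * Abelian subgroups of free groups *)

Section CyclicSubgroups.
Context {G : groupType}.
Implicit Types (a c x : G).

Lemma generated_set1 a x :
  generated [set a] x -> exists i j, x = a ^+ i / a ^+ j.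
Proof.
move: x; apply: generated_ind; first by exists 0, 0; rewrite mulgV.
move=> x _ -> [i [j ->]].
have cX k : commute (a ^+ k) a by apply/commute_sym/commuteX.
split; last by exists i, j.+1; rewrite expgS invgM mulgA.
exists i.+1, j; rewrite expgSr -!mulgA; congr (_ * _).
exact/commute_sym/commuteV/commute_sym.
Qed.

(** Pigeonhole: two of the powers of x with exponents 0, ..., size s have
    the same representative, so some power with exponent between 1 and size
    s lies in B, and the factorial makes the exponent independent of x. *)
Lemma subgroup_pow_factorial {A B : set G} {s : seq G} : subgroup B ->
  (forall x, A x -> exists b t, [/\ B b, t \in s & x = b * t]) ->
  subgroup A -> forall x, A x -> B (x ^+ (size s)`!).
Proof.
move=> sB AT sA x Ax.
have rep (i : 'I_(size s).+1) : exists j : 'I_(size s), B (x ^+ i / nth 1 s j).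
  have [b [t [Bb ts e]]] := AT _ (subgroupX i sA Ax).
  have ti : (index t s < size s)%N by rewrite index_mem.
  by exists (Ordinal ti); rewrite /= nth_index // e mulgK.
have [f fP] := choice rep.
have : ~~ injectiveb f.
  apply/negP => /injectiveP/leq_card; by rewrite !card_ord ltnn.
case/injectivePn => i [j nij fij].
have diff (i' j' : 'I_(size s).+1) : f i' = f j' -> (i' < j')%N ->
    B (x ^+ (size s)`!).
  move=> e lt.
  have Bd : B (x ^+ (j' - i')).
    rewrite expgnFr; last exact: ltnW.
    rewrite -(mulgKA (nth 1 s (f i'))^-1); have := subgroupF sB (fP j') (fP i').
    by rewrite e.
  have /dvdnP[m ->] : (j' - i' %| (size s)`!)%N.
    rewrite dvdn_fact // subn_gt0 lt /=; apply: leq_trans (leq_subr _ _) _.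
    by rewrite -ltnS.
  by rewrite mulnC expgnA; apply: subgroupX.
case: (ltngtP i j) nij => [lt|lt|/ord_inj->]; last by rewrite eqxx.
  by move=> _; apply: diff lt.
by move=> _; apply: diff lt.
Qed.

End CyclicSubgroups.

Lemma generated_free_gen (X : choiceType) (g : freeGroup X) :
  generated (range (@free_gen X)) g.
Proof.
have sS := generated_subgroup (range (@free_gen X)).
rewrite -[g]of_wordK; elim: (fword g) => [|[x b] w IHw].
  by rewrite of_word_nil; apply: (subgroup1 sS).
rewrite -cat1s of_word_cat; apply: (subgroupM sS) => //.
have Sx : generated (range (@free_gen X)) (free_gen x).
  by apply: sub_generated; exists x.
case: b; last by rewrite (_ : of_word _ = free_gen x) //; apply/val_inj.
rewrite (_ : of_word _ = (free_gen x)^-1); first exact: (subgroupV sS).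
exact/val_inj.
Qed.

Lemma free_of_rank_generated1 (X : choiceType) (c : freeGroup X) :
  c <> 1 -> free_of_rank (generated [set c]) 1.
Proof.
move=> c1; pose b (_ : 'I_1) := c.
have genI1 (g : freeGroup 'I_1) : generated [set free_gen ord0] g.
  apply: generatedS (generated_free_gen g) => _ [i _ <-].
  by rewrite [i]ord1.
exists b.
  apply: gmulf_inj => g.
  have [i [j ->]] := generated_set1 (genI1 g).
  have : c ^+ i / c ^+ j = 1 -> i = j.
    have aux m n : (m <= n)%N -> c ^+ n / c ^+ m = 1 -> m = n.
      move=> mn; rewrite -expgnFr // => e; apply/eqP; rewrite eqn_leq mn /=.
      rewrite leqNgt; apply/negP => lt; apply: c1.
      by apply: free_torsion_free e; rewrite subn_gt0.
    case/orP: (leq_total i j) => le; last by move/aux => ->.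
    by move/(congr1 (fun z => z^-1)); rewrite invgF invg1; apply: aux.
  rewrite gmulfF !gmulfXn /= free_lift_gen => cij /cij ->.
  by rewrite mulgV.
apply/seteqP; split=> [_ [g _ <-]|].
  have : (free_lift b @` generated [set free_gen ord0]) (free_lift b g).
    by exists g.
  move/image_generated; apply: generatedS => _ [_ -> <-].
  by rewrite /= free_lift_gen.
apply: generated_min => [|_ ->]; last first.
  by exists (free_gen ord0) => //; rewrite free_lift_gen.
apply: subgroup_image; exact/subgroupP.
Qed.

Lemma free_of_rank0 (G : groupType) (A : set G) :
  free_of_rank A 0 -> A `<=` [set 1].
Proof.
case=> b _ <- _ [[[|[[]]//] i] _ <-]; exact: big_nil.
Qed.

(** For a in A nontrivial, the cyclic subgroup <a> is normal in A, so of
    finite index, and a fixed power M sends all of A into <a>. If c has c ^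
    M = a ^ d with d > 0 minimal, Euclidean division of exponents shows that
    c generates A, as A is torsion free. *)
Lemma free_of_rank_abelian (X : finType) (A : set (freeGroup X)) :
  subgroup A -> (forall x y, A x -> A y -> commute x y) ->
  (exists2 a, A a & a <> 1) -> free_of_rank A 1.
Proof.
move=> sA abA [a Aa a1].
have sB := generated_subgroup [set a].
have BA : generated [set a] `<=` A by apply: generated_min => // _ ->.
have [|||T /finite_seqP[s ->] AT] := finite_index_of_normal sA BA.
- by move=> x b Ax Bb; rewrite conjgE (abA b x) ?mulKg //; apply: BA.
- exact/fin_gen_generated/finite_set1.
- by exists a => //; apply: sub_generated.
have powB := subgroup_pow_factorial sB AT sA.
set M := (_`!)%N in powB; have M0 : (0 < M)%N by apply: fact_gt0.
pose P d := `[< (0 < d)%N /\ exists2 c, A c & c ^+ M = a ^+ d >].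
have exP : exists d, P d by exists M; apply/asboolP; split=> //; exists a.
have [d /asboolP[d0 [c Ac cM]] mind] := ex_minnP exP.
have cyc x k : A x -> x ^+ M = a ^+ k -> exists q, x = c ^+ q.
  move=> Ax xM; exists (k %/ d)%N; apply: divg1_eq.
  have Ay : A (x / c ^+ (k %/ d)) by apply: subgroupF => //; apply: subgroupX.
  apply: (free_torsion_free M0).
  have yM : (x / c ^+ (k %/ d)) ^+ M = a ^+ (k %% d).
    rewrite expgnFl; last by apply: abA => //; apply: subgroupX.
    rewrite expgnAC cM xM {1}(divn_eq k d) addnC mulnC expgnDr !expgnA mulgK //.
  have [r0|r0] := posnP (k %% d); first by rewrite yM r0.
  have : P (k %% d) by apply/asboolP; split=> //; exists (x / c ^+ (k %/ d)).
  by move/mind; rewrite leqNgt ltn_mod d0.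
have Ac' : A `<=` generated [set c].
  move=> x Ax; have sC := generated_subgroup [set c].
  have Cc q : generated [set c] (c ^+ q).
    by apply: (subgroupX _ sC); apply: sub_generated.
  have [i [j xM]] := generated_set1 (powB _ Ax).
  case/orP: (leq_total j i) => le.
    have [|q ->] := cyc x (i - j)%N Ax; last exact: Cc.
    by rewrite expgnFr.
  have [||q e] := cyc x^-1 (j - i)%N; first exact: subgroupV.
    by rewrite expgnFr // expVgn xM invgF.
  by rewrite -[x]invgK e; apply: (subgroupV sC).
have -> : A = generated [set c].
  by apply/seteqP; split=> //; apply: generated_min => // _ ->.
apply: free_of_rank_generated1 => c1.
have [i [j e]] := generated_set1 (Ac' _ Aa).
by apply: a1; rewrite e c1 !expg1n mulgV.
Qed.

(** * Subgroups of free products *)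

Section FreeProductTheory.
Context {G H : groupType}.
Local Notation P := (freeProduct G H).
Implicit Types (A : set G) (B : set H) (w : P).

Section Lift.
Context {K : groupType}.
Context (f : UMagmaMorphism.type G K) (g : UMagmaMorphism.type H K).

Definition syllable_lift (s : G + H) : K :=
  match s with inl x => f x | inr y => g y end.

Definition fprod_lift w : K := \prod_(s <- nform w) syllable_lift s.

Lemma prod_spush s (u : seq (G + H)) :
  \prod_(r <- spush s u) syllable_lift r =
  syllable_lift s * \prod_(r <- u) syllable_lift r.
Proof.
have triv r : strivial r -> syllable_lift r = 1.
  by case: r => x /eqP ->; rewrite /= gmulf1.
rewrite /spush; case: ifPn => [/triv ->|_]; first by rewrite mul1g.
case: u => [|r u]; first by rewrite big_seq1 big_nil mulg1.
case E: (smul s r) => [c|]; last by rewrite big_cons.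
have sr : syllable_lift c = syllable_lift s * syllable_lift r.
  by case: s r E => x [] y //= [<-]; rewrite /= gmulfM.
rewrite big_cons mulgA -sr; case: ifPn => [/triv ->|_]; first by rewrite mul1g.
by rewrite big_cons.
Qed.

Lemma fprod_lift_morph : {morph fprod_lift : v w / v * w}.
Proof.
move=> v w; rewrite /fprod_lift.
change (nform (v * w)) with (nf_mul (nform v) (nform w)).
elim: (nform v) => [|s u IHu] /=; first by rewrite big_nil mul1g.
by rewrite prod_spush IHu big_cons mulgA.
Qed.

Lemma fprod_lift1 : fprod_lift 1 = 1.
Proof. exact: big_nil. Qed.

HB.instance Definition _ := isUMagmaMorphism.Build P K fprod_lift
  (conj fprod_lift1 fprod_lift_morph).

Lemma fprod_lift_inl x : fprod_lift (fprod_inl H x) = f x.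
Proof. by rewrite /fprod_lift prod_spush big_nil mulg1. Qed.

Lemma fprod_lift_inr y : fprod_lift (fprod_inr G y) = g y.
Proof. by rewrite /fprod_lift prod_spush big_nil mulg1. Qed.

End Lift.

Definition fprod_projl : UMagmaMorphism.type P G :=
  fprod_lift idfun (@one_fun H G).
Definition fprod_projr : UMagmaMorphism.type P H :=
  fprod_lift (@one_fun G H) idfun.

(** For subgroups A and B this is the free product A * B inside G * H, that
    is the subgroup generated by A and B. Describing it by syllables makes
    it commute with intersections. *)
Definition subproduct A B : set P :=
  [set w | forall s, s \in nform w ->
           match s with inl x => A x | inr y => B y end].

Lemma subproduct_ind A B (Q : P -> Prop) : Q 1 ->
  (forall x w, A x -> Q w -> Q (fprod_inl H x * w)) ->
  (forall y w, B y -> Q w -> Q (fprod_inr G y * w)) ->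
  forall w, subproduct A B w -> Q w.
Proof.
move=> Q1 Ql Qr [u nu]; elim: u nu => [|s u IHu] nu Ws.
  by rewrite (_ : FreeProduct nu = 1) //; apply/val_inj.
have {}IHu : Q (FreeProduct (nf_tail nu)).
  by apply: IHu => r ru; apply: Ws; rewrite inE ru orbT.
have := Ws s (mem_head _ _); have := spush_cons nu; case: s nu {Ws} IHu.
  move=> x nu Qu e Ax; have := Ql x _ Ax Qu; congr Q; apply/val_inj => /=.
  by rewrite nf_mul_push ?(nf_tail nu) //= e.
move=> y nu Qu e By; have := Qr y _ By Qu; congr Q; apply/val_inj => /=.
by rewrite nf_mul_push ?(nf_tail nu) //= e.
Qed.

Lemma subproduct_subgroup A B :
  subgroup A -> subgroup B -> subgroup (subproduct A B).
Proof.
move=> sA sB.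
pose C (s : G + H) := match s with inl x => A x | inr y => B y end.
have push s u : C s -> (forall r, r \in u -> C r) ->
    forall r, r \in spush s u -> C r.
  move=> Cs Cu; rewrite /spush; case: ifP => // _.
  case: u Cu => [|t u] Cu; first by move=> r; rewrite inE => /eqP ->.
  have Ct := Cu t (mem_head _ _).
  have Cu' r : r \in u -> C r by move=> ru; apply: Cu; rewrite inE ru orbT.
  case E: (smul s t) => [c|]; last first.
    by move=> r; rewrite inE => /predU1P[->//|/Cu].
  have Cc : C c.
    by case: s t Cs Ct E {Cu} => x [] y //= Cs Ct [<-]; apply: subgroupM.
  by case: ifP => // _ r; rewrite inE => /predU1P[->//|/Cu'].
apply/subgroupP; split=> [s|v w Cv Cw]; first by rewrite in_nil.
change (forall r, r \in nf_mul (nform v) (nf_inv (nform w)) -> C r).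
have {}Cw : forall r, r \in nf_inv (nform w) -> C r.
  move=> r; rewrite mem_rev => /mapP[t /Cw Ct ->].
  by case: t Ct => x /=; apply: subgroupV.
move: Cv; rewrite /subproduct /=; elim: (nform v) => //= s u IHu Cv.
apply: push; first exact: (Cv s (mem_head _ _)).
by apply: IHu => r ru; apply: Cv; rewrite inE ru orbT.
Qed.

Lemma subproduct_inl A B x : A x -> subproduct A B (fprod_inl H x).
Proof.
by move=> Ax s /=; rewrite /spush /=; case: ifP => // _; rewrite inE => /eqP ->.
Qed.

Lemma subproduct_inr A B y : B y -> subproduct A B (fprod_inr G y).
Proof.
by move=> By s /=; rewrite /spush /=; case: ifP => // _; rewrite inE => /eqP ->.
Qed.

(** Normal forms are unique, so belonging to all the A i * B i is a
    condition on each syllable separately. *)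
Lemma subproduct_bigcap J (A : J -> set G) (B : J -> set H) :
  \bigcap_i subproduct (A i) (B i) = subproduct (\bigcap_i A i) (\bigcap_i B i).
Proof.
apply/seteqP; split=> w Cw; last first.
  by move=> i _ s /Cw; case: s => x; apply.
by case=> x xw i _; apply: (Cw i I _ xw).
Qed.

Lemma subproduct_trivial A B w : A `<=` [set 1] \/ B `<=` [set 1] ->
  subproduct A B w ->
  w = fprod_inl H (fprod_projl w) * fprod_inr G (fprod_projr w).
Proof.
move=> AB Cw.
have [e|e] : w = fprod_inl H (fprod_projl w) \/ w = fprod_inr G (fprod_projr w).
- case: AB => AB; [right|left]; move: w Cw; apply: subproduct_ind.
  + by rewrite !gmulf1.
  + by move=> x w /AB -> ; rewrite gmulf1 mul1g.
  + move=> y w _ {1}->; by rewrite gmulfM /= fprod_lift_inr gmulfM.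
  + by rewrite !gmulf1.
  + move=> x w _ {1}->; by rewrite gmulfM /= fprod_lift_inl gmulfM.
  + by move=> y w /AB -> ; rewrite gmulf1 mul1g.
- by rewrite e /= !fprod_lift_inl /= gmulf1 mulg1.
- by rewrite e /= !fprod_lift_inr /= gmulf1 mul1g.
Qed.

Lemma fin_gen_subproduct A B :
  fin_gen A -> fin_gen B -> fin_gen (subproduct A B).
Proof.
move=> fgA fgB; have sA := fin_gen_subgroup fgA.
have sB := fin_gen_subgroup fgB; move: fgA fgB => [S1 fS1 SA] [S2 fS2 SB].
have sub1 g : S1 g -> A g by move=> Sg; rewrite -SA; apply: sub_generated.
have sub2 g : S2 g -> B g by move=> Sg; rewrite -SB; apply: sub_generated.
pose S := @fprod_inl G H @` S1 `|` @fprod_inr G H @` S2.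
have sS : subgroup (generated S) by apply: generated_subgroup.
apply: (fin_gen_between (S := S)).
- by rewrite finite_setU; split; apply: finite_image.
- exact: subproduct_subgroup.
- move=> _ [[g /sub1 Hg <-]|[g /sub2 Hg <-]]; first exact: subproduct_inl.
  exact: subproduct_inr.
apply: subproduct_ind; first exact: (subgroup1 sS).
  move=> x w Ax Sw; apply: (subgroupM sS) => //.
  apply: (generatedS (S := @fprod_inl G H @` S1)); first by move=> ?; left.
  by apply: image_generated; exists x; rewrite ?SA.
move=> x w Ax Sw; apply: (subgroupM sS) => //.
apply: (generatedS (S := @fprod_inr G H @` S2)); first by move=> ?; right.
by apply: image_generated; exists x; rewrite ?SB.
Qed.

End FreeProductTheory.

(** * Projections of an intersection to the free part *)

HB.instance Definition _ (G H : groupType) :=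
  isUMagmaMorphism.Build (G * H)%type G fst (conj erefl (fun _ _ => erefl)).

Section IntersectionOfProjections.
Context {n m : nat} {J : Type} (H : J -> set (FxZ n m)).
Context (sgH : forall j, subgroup (H j)).

Local Notation A := (\bigcap_j (fst @` H j)).
Local Notation B := (fst @` \bigcap_j H j).

Lemma subgroup_bigcap_proj : subgroup A.
Proof. by apply: subgroup_bigcap => j _; apply: subgroup_image. Qed.

Lemma proj_bigcap_sub : B `<=` A.
Proof. by move=> _ [h Hh <-] j _; exists h => //; apply: Hh. Qed.

(** Conjugating (b, s) by (a, t_j) does not see t_j, so the result (b ^ a,
    s) is the same for all j although no single lift of a need lie in all
    the H j. *)
Lemma proj_bigcap_normal a b : A a -> B b -> B (b ^ a).
Proof.
move=> Aa [h Hh <-]; exists (h.1 ^ a, h.2) => // j _.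
have [g Hg <-] := Aa j I; have Hh' := Hh j I.
have -> : (h.1 ^ g.1, h.2) = h ^ g.
  apply/eqP; rewrite xpair_eqE /=; apply/andP; split=> //=.
  by rewrite eq_sym; apply/eqP/conjg_fixP/commgP/Algebra.commuteT.
by rewrite conjgE; do ?apply: subgroupM => //; apply: subgroupV.
Qed.

(** Likewise the commutator of arbitrary lifts has trivial abelian part: it
    is the same element of every H j. *)
Lemma proj_bigcap_commutator x y : A x -> A y -> B [~ x, y].
Proof.
move=> Ax Ay; exists ([~ x, y], 1) => // j _.
have [g Hg <-] := Ax j I; have [h Hh <-] := Ay j I.
have -> : ([~ g.1, h.1], 1) = [~ g, h].
  apply/eqP; rewrite xpair_eqE /=; apply/andP; split=> //=.
  by rewrite eq_sym; apply/commgP/Algebra.commuteT.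
by rewrite commgEl conjgE; do ?apply: subgroupM => //; apply: subgroupV.
Qed.

(** This is where the hypothesis on the ranks enters: a nontrivial A of rank
    different from 1 is not abelian, so B, which contains its commutators,
    is nontrivial. *)
Lemma finite_index_of_fin_gen :
  ~ A `<=` [set 1] -> rank A <> Some 1%N -> fin_gen (\bigcap_j H j) ->
  exists2 T, finite_set T &
    forall a, A a -> exists b t, [/\ B b, T t & a = b * t].
Proof.
move=> An1 rkA fgH; have sA := subgroup_bigcap_proj.
apply: finite_index_of_normal => //.
- exact: proj_bigcap_sub.
- exact: proj_bigcap_normal.
- exact: fin_gen_image.
apply: contrapT => B1; apply: rkA; apply: rankE.
apply: free_of_rank_abelian => //; last first.
  apply: contrapT => A1; apply: An1 => a Aa; apply: contrapT => a1.
  by apply: A1; exists a.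
(* if B were trivial, A would be abelian *)
move=> x y Ax Ay; apply/commgP/eqP; apply: contrapT => xy; apply: B1.
by exists [~ x, y] => //; apply: proj_bigcap_commutator.
Qed.

End IntersectionOfProjections.

(** * Joins in the strongly complementary product *)

Section StronglyComplementary.
Context {n1 m1 n2 m2 : nat}.
Local Notation G1 := (FxZ n1 m1).
Local Notation G2 := (FxZ n2 m2).
Local Notation P := (scprod n1 m1 n2 m2).
Implicit Types (x : P).

Definition scprod_projl x : G1 := (fprod_projl x.1, x.2.1).
Definition scprod_projr x : G2 := (fprod_projr x.1, x.2.2).

Lemma scprod_projl_morph : {morph scprod_projl : x y / x * y}.
Proof. by move=> x y; rewrite /scprod_projl gmulfM. Qed.
Lemma scprod_projr_morph : {morph scprod_projr : x y / x * y}.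
Proof. by move=> x y; rewrite /scprod_projr gmulfM. Qed.
Lemma scprod_projl1 : scprod_projl 1 = 1.
Proof. by rewrite /scprod_projl gmulf1. Qed.
Lemma scprod_projr1 : scprod_projr 1 = 1.
Proof. by rewrite /scprod_projr gmulf1. Qed.
Lemma scprod_inl1 : @scprod_inl n1 m1 n2 m2 1 = 1.
Proof. by rewrite /scprod_inl gmulf1. Qed.
Lemma scprod_inr1 : @scprod_inr n1 m1 n2 m2 1 = 1.
Proof. by rewrite /scprod_inr gmulf1. Qed.

HB.instance Definition _ := isUMagmaMorphism.Build P G1 scprod_projl
  (conj scprod_projl1 scprod_projl_morph).
HB.instance Definition _ := isUMagmaMorphism.Build P G2 scprod_projr
  (conj scprod_projr1 scprod_projr_morph).
HB.instance Definition _ := isUMagmaMorphism.Build G1 P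
  (@scprod_inl n1 m1 n2 m2)
  (conj scprod_inl1 (@scprod_inl_morph n1 m1 n2 m2)).
HB.instance Definition _ := isUMagmaMorphism.Build G2 P
  (@scprod_inr n1 m1 n2 m2)
  (conj scprod_inr1 (@scprod_inr_morph n1 m1 n2 m2)).

Local Notation in1 := (@scprod_inl n1 m1 n2 m2).
Local Notation in2 := (@scprod_inr n1 m1 n2 m2).

Lemma scprod_projl_inl g : scprod_projl (in1 g) = g.
Proof. by case: g => a t; rewrite /scprod_projl /= fprod_lift_inl. Qed.
Lemma scprod_projr_inl g : scprod_projr (in1 g) = 1.
Proof. by case: g => a t; rewrite /scprod_projr /= fprod_lift_inl. Qed.
Lemma scprod_projl_inr g : scprod_projl (in2 g) = 1.
Proof. by case: g => a t; rewrite /scprod_projl /= fprod_lift_inr. Qed.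
Lemma scprod_projr_inr g : scprod_projr (in2 g) = g.
Proof. by case: g => a t; rewrite /scprod_projr /= fprod_lift_inr. Qed.

Lemma scprod_split x :
  x.1 = fprod_inl _ (fprod_projl x.1) * fprod_inr _ (fprod_projr x.1) ->
  x = in1 (scprod_projl x) * in2 (scprod_projr x).
Proof.
case: x => w [t1 t2] /= e.
pose w' := fprod_inl _ (fprod_projl w) * fprod_inr _ (fprod_projr w).
rewrite [LHS](_ : _ = (w', (t1, t2))); last by rewrite /w' -e.
by congr pair; congr pair; rewrite ?GRing.addr0 ?GRing.add0r.
Qed.

(** The shape shared by each join <H1, H2> and by their intersection. In an
    element of <H1, H2> the abelian coordinates depend on the syllables of
    the free part only through the products of those on each side, because
    they add up in an abelian group; so the two conditions on the
    projections determine them. *)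
Definition subjoin (C : set (freeProduct 'Free_n1 'Free_n2))
    (H1 : set G1) (H2 : set G2) : set P :=
  fst @^-1` C `&` (scprod_projl @^-1` H1 `&` scprod_projr @^-1` H2).

(** The left to right inclusion checks the generators; for the converse, the
    syllables of the free part are lifted one by one to H1 and H2 and split
    off, until only an abelian part in H1 and one in H2 are left. *)
Lemma scjoinE (H1 : set G1) (H2 : set G2) : subgroup H1 -> subgroup H2 ->
  scjoin H1 H2 = subjoin (subproduct (fst @` H1) (fst @` H2)) H1 H2.
Proof.
move=> s1 s2; apply/seteqP; split.
  apply: generated_min.
    apply: subgroupI; last by apply: subgroupI; apply: subgroup_preimage.
    apply: subgroup_preimage.
    by apply: subproduct_subgroup; apply: subgroup_image.
  move=> _ [[g Hg <-]|[g Hg <-]]; split=> /=.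
  - by apply: subproduct_inl; exists g.
  - split; rewrite /preimage /= ?scprod_projl_inl ?scprod_projr_inl //.
    exact: subgroup1.
  - by apply: subproduct_inr; exists g.
  - split; rewrite /preimage /= ?scprod_projl_inr ?scprod_projr_inr //.
    exact: subgroup1.
have sJ : subgroup (scjoin H1 H2) by apply: generated_subgroup.
have Jl g : H1 g -> scjoin H1 H2 (in1 g).
  by move=> Hg; apply: sub_generated; left; exists g.
have Jr g : H2 g -> scjoin H1 H2 (in2 g).
  by move=> Hg; apply: sub_generated; right; exists g.
move=> x [] /=; move: {2}x.1 (erefl x.1) => w ew Cw; rewrite ew in Cw.
move: w Cw x ew; apply: subproduct_ind.
- move=> x x1 [Hl Hr]; rewrite [x]scprod_split; last by rewrite x1 !gmulf1 mulg1.
  by apply: (subgroupM sJ); [apply: Jl|apply: Jr].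
- move=> a w [g Hg <-] IH x ex [Hl Hr].
  rewrite -[x](mulVKg (in1 g)); apply: (subgroupM sJ); first exact: Jl.
  apply: IH.
    by rewrite [LHS](_ : _ = (fprod_inl 'Free_n2 g.1)^-1 * x.1) // ex mulKg.
  split; rewrite /preimage /=.
    rewrite gmulfM gmulfV /= scprod_projl_inl; apply: subgroupM => //.
    exact: subgroupV.
  by rewrite gmulfM gmulfV /= scprod_projr_inl invg1 mul1g.
- move=> a w [g Hg <-] IH x ex [Hl Hr].
  rewrite -[x](mulVKg (in2 g)); apply: (subgroupM sJ); first exact: Jr.
  apply: IH.
    by rewrite [LHS](_ : _ = (fprod_inr 'Free_n1 g.1)^-1 * x.1) // ex mulKg.
  split; rewrite /preimage /=.
    by rewrite gmulfM gmulfV /= scprod_projl_inr invg1 mul1g.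
  rewrite gmulfM gmulfV /= scprod_projr_inr; apply: subgroupM => //.
  exact: subgroupV.
Qed.

Lemma bigcap_scjoinE J (H1 : J -> set G1) (H2 : J -> set G2) :
  (forall j, subgroup (H1 j)) -> (forall j, subgroup (H2 j)) ->
  \bigcap_j scjoin (H1 j) (H2 j) =
  subjoin (subproduct (\bigcap_j (fst @` H1 j)) (\bigcap_j (fst @` H2 j)))
    (\bigcap_j H1 j) (\bigcap_j H2 j).
Proof.
move=> s1 s2; rewrite /subjoin -subproduct_bigcap; apply/seteqP; split=> x.
  move=> Jx; do !split; move=> j _; have := Jx j I; rewrite scjoinE //;
  by case=> ? [].
move=> [xC [x1 x2]] j _; rewrite scjoinE //.
by do !split; [apply: xC|apply: x1|apply: x2].
Qed.

Section FiniteGeneration.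
Context {A1 : set 'Free_n1} {A2 : set 'Free_n2} {H1 : set G1} {H2 : set G2}.
Context (sA1 : subgroup A1) (sA2 : subgroup A2).
Context (sH1 : subgroup H1) (sH2 : subgroup H2).
Context (HA1 : fst @` H1 `<=` A1) (HA2 : fst @` H2 `<=` A2).

Local Notation K := (subjoin (subproduct A1 A2) H1 H2).

Lemma subjoin_subgroup : subgroup K.
Proof.
apply: subgroupI; last by apply: subgroupI; apply: subgroup_preimage.
by apply: subgroup_preimage; apply: subproduct_subgroup.
Qed.

Lemma subjoin_inl g : H1 g -> K (in1 g).
Proof.
move=> Hg; split; first by apply: subproduct_inl; apply: HA1; exists g.
split; rewrite /preimage /= ?scprod_projl_inl ?scprod_projr_inl //.
exact: subgroup1.
Qed.

Lemma subjoin_inr g : H2 g -> K (in2 g).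
Proof.
move=> Hg; split; first by apply: subproduct_inr; apply: HA2; exists g.
split; rewrite /preimage /= ?scprod_projl_inr ?scprod_projr_inr //.
exact: subgroup1.
Qed.

(** H1 and H2 are retracts of K. *)
Lemma fin_gen_factors : fin_gen K -> fin_gen H1 /\ fin_gen H2.
Proof.
move=> fgK; split.
  have <- : scprod_projl @` K = H1; last exact: fin_gen_image.
  apply/seteqP; split=> [_ [x [_ [Hx _]] <-]//|g Hg].
  by exists (in1 g); [apply: subjoin_inl|apply: scprod_projl_inl].
have <- : scprod_projr @` K = H2; last exact: fin_gen_image.
apply/seteqP; split=> [_ [x [_ [_ Hx]] <-]//|g Hg].
by exists (in2 g); [apply: subjoin_inr|apply: scprod_projr_inr].
Qed.

Lemma proj_subjoin : fst @` K = subproduct A1 A2 `&`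
  (fprod_projl @^-1` (fst @` H1) `&` fprod_projr @^-1` (fst @` H2)).
Proof.
apply/seteqP; split=> [_ [x [Cx [Hl Hr]] <-]|w [Cw [[g Hg eg] [h Hh eh]]]].
  by split=> //; split; [exists (scprod_projl x)|exists (scprod_projr x)].
exists (w, (g.2, h.2)) => //; split=> //; split; rewrite /preimage /=.
  by rewrite /scprod_projl /= -eg; case: (g) Hg.
by rewrite /scprod_projr /= -eh; case: (h) Hh.
Qed.

Lemma subjoin_split_generators : fin_gen H1 -> fin_gen H2 ->
  exists2 S, finite_set S & S `<=` K /\
    forall x, K x ->
    x.1 = fprod_inl _ (fprod_projl x.1) * fprod_inr _ (fprod_projr x.1) ->
    generated S x.
Proof.
move=> [S1 fS1 S1H] [S2 fS2 S2H].
have sub1 g : S1 g -> H1 g by move=> Sg; rewrite -S1H; apply: sub_generated.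
have sub2 g : S2 g -> H2 g by move=> Sg; rewrite -S2H; apply: sub_generated.
exists (in1 @` S1 `|` in2 @` S2).
  by rewrite finite_setU; split; apply: finite_image.
split.
  move=> _ [[g /sub1 Hg <-]|[g /sub2 Hg <-]]; first exact: subjoin_inl.
  exact: subjoin_inr.
move=> x [_ [Hl Hr]] /scprod_split ->.
apply: (subgroupM (generated_subgroup _)).
  apply: (generatedS (S := in1 @` S1)); first by move=> ?; left.
  by apply: image_generated; exists (scprod_projl x); rewrite ?S1H.
apply: (generatedS (S := in2 @` S2)); first by move=> ?; right.
by apply: image_generated; exists (scprod_projr x); rewrite ?S2H.
Qed.

Lemma fin_gen_subjoin_trivial : fin_gen H1 -> fin_gen H2 ->
  A1 `<=` [set 1] \/ A2 `<=` [set 1] -> fin_gen K.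
Proof.
move=> fg1 fg2 A0; have [S fS [SK genS]] := subjoin_split_generators fg1 fg2.
apply: (fin_gen_between fS subjoin_subgroup SK) => x Kx.
by apply: genS => //; apply: subproduct_trivial A0 _; case: Kx.
Qed.

Lemma fin_gen_subjoin_of_proj :
  fin_gen H1 -> fin_gen H2 -> fin_gen (fst @` K) -> fin_gen K.
Proof.
move=> fg1 fg2 fgN; have [S fS [SK genS]] := subjoin_split_generators fg1 fg2.
apply: (fin_gen_extension subjoin_subgroup fgN); exists S => //; split=> //.
by move=> x Kx x1; apply: genS => //; rewrite x1 !gmulf1 mulg1.
Qed.

(** The coset of an element of A1 * A2 modulo the free part of K is
    determined by the cosets of its two projections modulo those of H1 and
    H2, so the products of a representative from each side represent all the
    cosets. Schreier's lemma then makes the free part of K finitely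
    generated. *)
Lemma fin_gen_subjoin_finite_index T1 T2 : finite_set T1 -> finite_set T2 ->
  (forall a, A1 a -> exists b t, [/\ (fst @` H1) b, T1 t & a = b * t]) ->
  (forall a, A2 a -> exists b t, [/\ (fst @` H2) b, T2 t & a = b * t]) ->
  fin_gen H1 -> fin_gen H2 -> fin_gen K.
Proof.
move=> fT1 fT2 cos1 cos2 fg1 fg2; apply: fin_gen_subjoin_of_proj => //.
have fgA1 := fin_gen_cosets sA1 (fin_gen_image _ fg1) HA1 fT1 cos1.
have fgA2 := fin_gen_cosets sA2 (fin_gen_image _ fg2) HA2 fT2 cos2.
pose T := [set fprod_inl 'Free_n2 t.1 * fprod_inr 'Free_n1 t.2 |
           t in (T1 `&` A1) `*` (T2 `&` A2)].
have sC := subproduct_subgroup sA1 sA2.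
apply: (fin_gen_finite_index (D := subproduct A1 A2) (T := T)).
- by apply: subgroup_image; apply: subjoin_subgroup.
- exact: fin_gen_subproduct.
- by rewrite proj_subjoin => w [].
- apply: finite_image; apply: finite_setX; first exact: sub_finite_set fT1.
  exact: sub_finite_set fT2.
rewrite proj_subjoin => w Cw.
have [Pl Pr] : A1 (fprod_projl w) /\ A2 (fprod_projr w).
  move: w Cw; apply: subproduct_ind.
  - by rewrite !gmulf1; split; apply: subgroup1.
  - move=> x w Ax [Al Ar]; rewrite !gmulfM /= !fprod_lift_inl /= mul1g.
    by split=> //; apply: subgroupM.
  - move=> x w Ax [Al Ar]; rewrite !gmulfM /= !fprod_lift_inr /= mul1g.
  by split=> //; apply: subgroupM.
have [b1 [t1 [Bb1 [Tt1 At1] e1]]] := cosets_inter sA1 HA1 cos1 Pl.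
have [b2 [t2 [Bb2 [Tt2 At2] e2]]] := cosets_inter sA2 HA2 cos2 Pr.
pose t : freeProduct 'Free_n1 'Free_n2 := fprod_inl _ t1 * fprod_inr _ t2.
exists (w / t), t; split; last by rewrite mulgVK.
  split.
    apply: (subgroupF sC) => //; apply: (subgroupM sC).
      exact: subproduct_inl.
    exact: subproduct_inr.
  split; rewrite /preimage /=.
    by rewrite gmulfF gmulfM /= fprod_lift_inl fprod_lift_inr /= mulg1 e1 mulgK.
  by rewrite gmulfF gmulfM /= fprod_lift_inl fprod_lift_inr /= mul1g e2 mulgK.
by exists (t1, t2).
Qed.

End FiniteGeneration.
End StronglyComplementary.

(** * Finite generation of the intersection of the joins *)

Lemma rank_Some (G : groupType) (A : set G) n :
  rank A = Some n -> free_of_rank A n.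
Proof. by rewrite /rank; case: pselect => // ex [<-]; case: cid. Qed.

Theorem theorem2p14 (n' m' n'' m'' k : nat) (hk : (2 <= k)%N)
    (H' : 'I_k -> set (FxZ n' m')) (H'' : 'I_k -> set (FxZ n'' m''))
    (sgH' : forall j, subgroup (H' j)) (sgH'' : forall j, subgroup (H'' j)) :
  let r' := rank (\bigcap_j (fst @` H' j)) in
  let r'' := rank (\bigcap_j (fst @` H'' j)) in
  min_rank r' r'' <> Some 1%N ->
  fin_gen (\bigcap_j scjoin (H' j) (H'' j)) <->
  fin_gen (\bigcap_j H' j) /\ fin_gen (\bigcap_j H'' j).
Proof.
move=> r' r'' rk; rewrite bigcap_scjoinE //.
have sA' := subgroup_bigcap_proj sgH'; have sA'' := subgroup_bigcap_proj sgH''.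
have sH' : subgroup (\bigcap_j H' j) by apply: subgroup_bigcap => j _.
have sH'' : subgroup (\bigcap_j H'' j) by apply: subgroup_bigcap => j _.
have HA' := proj_bigcap_sub (H := H'); have HA'' := proj_bigcap_sub (H := H'').
split; first exact: fin_gen_factors.
case=> fg' fg''.
have [A'1|A'n1] := pselect (\bigcap_j (fst @` H' j) `<=` [set 1]).
  by apply: fin_gen_subjoin_trivial => //; left.
have [A''1|A''n1] := pselect (\bigcap_j (fst @` H'' j) `<=` [set 1]).
  by apply: fin_gen_subjoin_trivial => //; right.
have pos (G : groupType) (A : set G) : ~ A `<=` [set 1] -> rank A <> Some 0%N.
  by move=> An1 /rank_Some/free_of_rank0.
have rk' : r' <> Some 1%N.
  move=> e; apply: rk; rewrite e /=; move: (pos _ _ A''n1); rewrite -/r''.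
  by case: r'' => [[|p]|] // _; rewrite minnSS min0n.
have rk'' : r'' <> Some 1%N.
  move=> e; apply: rk; rewrite e /=; move: (pos _ _ A'n1); rewrite -/r'.
  by case: (r') => [[|p]|] // _; rewrite /min_rank minnSS minn0.
have [T' fT' cos'] := finite_index_of_fin_gen sgH' A'n1 rk' fg'.
have [T'' fT'' cos''] := finite_index_of_fin_gen sgH'' A''n1 rk'' fg''.
exact: fin_gen_subjoin_finite_index cos' cos'' fg' fg''.
Qed.
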